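(* Let $\gamma>0$ be arbitrary and $\varepsilon>0$. Let $\mathcal A$ be an $\varepsilon$-edge differentially private algorithm on graphs with vertex set $V$, $|V|=n$, which outputs an implicit solution $\mathcal S=\{S_v\}_{v\in V}$ such that, on every input graph $G$, with probability at least $1-\beta$ the implicit graph $G\cap H(\mathcal S)$ has the size of a $\gamma$-approximate maximal matching of $G$, where $\beta\le 1/(16e^{4\varepsilon})$. Then there is an input graph on which the degree of the implicit solution is at least $\Omega\!\left(\frac1\varepsilon\log(1/\beta)\right)$ with probability at least $1/2$ (the constant in $\Omega$ being absolute), regardless of the value of $\gamma$.
   Context: An implicit solution for a graph $G=(V,E)$ is a collection $\mathcal S=\{S_v\}_{v\in V}$ with $S_v\subseteq V$. It defines the graph $H(\mathcal S)=(V,E')$ with $E'=\{\{u,v\}: u\in S_v\text{ or }v\in S_u\}$; the implicit graph is $(V,E\cap E')$ and the degree of $\mathcal S$ is the maximum degree of the implicit graph. A subgraph $F$ has the size of a $\gamma$-approximate maximal matching if there is a maximal matching of $G$ of size $M$ with $|F|\ge M/\gamma$. Edge-neighboring graphs differ in exactly one pair; $\varepsilon$-edge DP means $\Pr[\mathcal A(G)\in S]\le e^{\varepsilon}\Pr[\mathcal A(G')\in S]$ for all edge-neighboring $G,G'$ and output sets $S$.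
   Formalization: The degree bound is capped: it is Ω(min(n−1, (1/ε)log(1/β))) with β>0, since a degree never exceeds n−1 and the uncapped bound fails for fixed n as β→0 (take S_v=V for all v). *)

(* Defs.v *)
From HB Require Import structures.
From mathcomp Require Import all_boot all_order all_algebra.
From mathcomp Require Import all_classical all_reals all_analysis.

Set Implicit Arguments.
Unset Strict Implicit.
Unset Printing Implicit Defensive.

Import Order.TTheory GRing.Theory Num.Theory.
Local Open Scope ring_scope.

(* Finite simple graphs on a fixed vertex set V, given by their edge set. *)
Record sgraph (V : finType) := SGraph {
  edges :> {set {set V}};
  card_edge : forall e, e \in edges -> #|e| = 2%N
}.

Section Graphs.
Variable V : finType.
Implicit Types (G H F : sgraph V) (M : {set {set V}}).

Fact sgraphI_subproof G H e : e \in edges G :&: edges H -> #|e| = 2%N.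
Proof. by rewrite inE => /andP[/card_edge]. Qed.

Definition sgraphI G H : sgraph V := SGraph (@sgraphI_subproof G H).

Definition degree G (v : V) : nat := #|[set e in edges G | v \in e]%SET|.

Definition max_degree G : nat := \max_(v : V) degree G v.

Definition edge_neighbors G H : Prop :=
  #|(edges G :\: edges H) :|: (edges H :\: edges G)| = 1%N.

Definition is_matching G M : bool := (M \subset edges G) && finset.trivIset M.

Definition is_maximal_matching G M : bool := maxset (is_matching G) M.

Definition approx_maximal_matching_size (R : realType) (gamma : R) G F : Prop :=
  exists2 M, is_maximal_matching G M & #|M|%:R / gamma <= #|edges F|%:R.

End Graphs.

(* An implicit solution is a family S of sets of vertices indexed by V. *)
Definition implicit_solution (V : finType) : Type := {ffun V -> {set V}}.

Section ImplicitSolutions.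
Variable V : finType.

HB.instance Definition _ := Finite.on (implicit_solution V).
HB.instance Definition _ :=
  isPointed.Build (implicit_solution V) [ffun=> finset.set0].
(* Every set of implicit solutions is an event. *)
HB.instance Definition _ := @isMeasurable.Build default_measure_display
  (implicit_solution V) discrete_measurable discrete_measurable0
  discrete_measurableC discrete_measurableU.

Implicit Type S : implicit_solution V.

(* The pairs {u, v} have u != v: a vertex v with v \in S v yields no loop. *)
Definition solution_edges S : {set {set V}} :=
  [set e : {set V} | [exists u, exists v,
     [&& u != v, e == [set u; v]%SET & (u \in S v) || (v \in S u)]]]%SET.

Fact solution_graph_subproof S e : e \in solution_edges S -> #|e| = 2%N.
Proof.
by rewrite inE => /existsP[u /existsP[v /and3P[uv /eqP-> _]]]; rewrite cards2 uv.
Qed.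

Definition solution_graph S : sgraph V := SGraph (@solution_graph_subproof S).

Definition implicit_graph (G : sgraph V) S : sgraph V :=
  sgraphI G (solution_graph S).

End ImplicitSolutions.

(* A randomized algorithm is identified with the map sending each input graph
   to the law of the output. *)
Definition randomized_algorithm (R : realType) (V : finType) : Type :=
  sgraph V -> probability (implicit_solution V) R.

Definition edge_DP (R : realType) (V : finType) (eps : R)
    (A : randomized_algorithm R V) : Prop :=
  forall G G' : sgraph V, edge_neighbors G G' ->
  forall O : set (implicit_solution V),
    (A G O <= (expR eps)%:E * A G' O)%E.

(* Main.v *)
Require Import Defs.
From mathcomp Require Import all_boot all_order all_algebra.
From mathcomp Require Import all_classical all_reals all_analysis.
From mathcomp Require Import measurable_realfun ring lra.

(* On a graph with a single edge {v, u}, every approximation factor forces the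
   implicit graph to contain that edge, so it is missed with probability at
   most beta.  A star with k leaves is k - 1 edge deletions away from each of
   its edges, hence group privacy bounds the probability that it misses a given
   edge by exp(eps (k - 1)) beta.  With k - 1 the integer part of
   ln(1 / beta) / (2 eps), or k = |V| - 1 if that is smaller, this is at most
   sqrt beta <= 1/4, and Markov's inequality applied to the number of missed
   edges shows that at least k / 2 edges at the centre survive with probability
   at least 1/2. *)

Import Order.TTheory GRing.Theory Num.Theory.
Local Open Scope ring_scope.

(** Markov's inequality for the number of events [B i] that occur: integrate the pointwise bound
    [r * \1_X <= \sum_(i in U) \1_(B i)]. *)
Lemma measure_markov_count {d} {T : measurableType d} {R : realType}
    (mu : measure T R) {I : finType} (U : {set I}) (B : I -> set T)
    (X : set T) (r : R) :
  (forall i, measurable (B i)) -> measurable X -> 0 <= r ->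
  (forall x, X x -> r <= \sum_(i in U) \1_(B i) x) ->
  (r%:E * mu X <= \sum_(i in U) mu (B i))%E.
Proof.
move=> mB mX r0 rX.
have mE (Y : set T) : measurable Y ->
    measurable_fun [set: T] (EFin \o (\1_Y : T -> R)).
  by move=> mY; apply/measurable_EFinP/measurable_indic.
have -> : mu X = (\int[mu]_x (\1_X x)%:E)%E by rewrite integral_indic ?setIT.
have -> : (\sum_(i in U) mu (B i) =
    \int[mu]_x \sum_(i <- enum U) (\1_(B i) x)%:E)%E.
  rewrite ge0_integral_sum// => [|i]; last exact: mE.
  by rewrite big_enum; apply: eq_bigr => i _; rewrite integral_indic ?setIT.
rewrite -ge0_integralZl_EFin//; last exact: mE.
apply: ge0_le_integral => //.
- by move=> x _; rewrite -EFinM lee_fin mulr_ge0.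
- by apply: emeasurable_funM => //; exact: mE.
- by apply: emeasurable_sum => i _; exact: mE.
move=> x _; rewrite sumEFin big_enum -EFinM lee_fin.
have -> : \1_X x = (x \in X)%:R :> R by [].
case: (boolP (x \in X)) => [/set_mem/rX|_]; rewrite ?mulr1// mulr0.
by move=> *; apply: sumr_ge0.
Qed.

Section Subgraph.
Context {V : finType}.
Implicit Types (G H : sgraph V) (v u : V) (U : {set V}).

(** * Edge deletion and group privacy *)

Fact delete_edge_subproof G e f : f \in edges G :\ e -> #|f| = 2.
Proof. by rewrite inE => /andP[_ /card_edge]. Qed.

Definition delete_edge G e := SGraph (delete_edge_subproof G e).

Lemma delete_edge_neighbors G e : e \in edges G ->
  edge_neighbors G (delete_edge G e).
Proof.
move=> eG; rewrite /edge_neighbors /= -[RHS](cards1 e); apply: eq_card => f.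
rewrite !inE; have [->|_] := eqVneq f e; first by rewrite eG.
by rewrite /= !andNb.
Qed.

(** Group privacy, by induction on the number of surplus edges: each single deletion costs one
    factor [expR eps]. *)
Lemma edge_DP_subgraph {R : realType} {eps : R} {A : randomized_algorithm R V}
    {G H} (O : set (implicit_solution V)) :
  edge_DP eps A -> edges H \subset edges G ->
  (A G O <= (expR (eps * #|edges G :\: edges H|%:R))%:E * A H O)%E.
Proof.
move=> dpA; move: {2}#|_ :\: _| (erefl #|edges G :\: edges H|) => m.
elim: m G => [|m IHm] G.
  move=> /eqP cGH sHG; rewrite (eqP cGH) mulr0 expR0 mul1e.
  move: cGH; rewrite cards_eq0 finset.setD_eq0 => sGH.
  have eGH : edges G = edges H by apply/eqP; rewrite finset.eqEsubset sGH.
  suff -> : G = H by [].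
  case: G H eGH {sHG sGH} => [E cE] [E' cE'] /= eE; rewrite -eE in cE' *.
  by congr SGraph; exact: Prop_irrelevance.
move=> cGH sHG; have /card_gt0P[e] : (0 < #|edges G :\: edges H|)%N.
  by rewrite cGH.
rewrite inE => /andP[eH eG].
have eqD : edges (delete_edge G e) :\: edges H = (edges G :\: edges H) :\ e.
  by apply/setP => f; rewrite !inE andbCA.
have cD : #|edges (delete_edge G e) :\: edges H| = m.
  by rewrite eqD; apply/eqP; rewrite -eqSS -cGH [eqbRHS](cardsD1 e) !inE eH eG.
have sHD : edges H \subset edges (delete_edge G e).
  apply/fintype.subsetP => f fH; rewrite !inE (fintype.subsetP sHG)// andbT.
  by apply: contraNneq eH => <-.
apply: le_trans (dpA _ _ (delete_edge_neighbors _ _ eG) O) _.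
rewrite cGH -natr1 mulrDr mulr1 addrC expRD EFinM -muleA.
apply: lee_wpmul2l; first by rewrite lee_fin expR_ge0.
by move: (IHm _ cD sHD); rewrite cD.
Qed.

(** * Stars and their single edges *)

Fact star_subproof v U e :
  e \in [set [set v; u] | u in U :\ v] -> #|e| = 2.
Proof.
by case/imsetP => u; rewrite !inE => /andP[uv _] ->; rewrite cards2 eq_sym uv.
Qed.

(** Taking [U :\ v] excludes the degenerate pair [[set v; v]], so that a star is defined for every
    [U]. *)
Definition star v U := SGraph (star_subproof v U).

Lemma setU2_injr v : injective (fun u => [set v; u]).
Proof.
move=> u w /setP E; move: (E u) (E w); rewrite !inE !eqxx !orbT.
have [->|_ /=] := eqVneq u v; last by move/esym/eqP.
by move=> _; rewrite orbb => /eqP.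
Qed.

Lemma leq_star_degree v U H :
  (#|[set u in U | [set v; u] \in edges H]| <= degree H v)%N.
Proof.
rewrite -(card_imset _ (setU2_injr v)); apply: subset_leq_card.
apply/fintype.subsetP => _ /imsetP[u + ->]; rewrite !inE => /andP[_ ->].
by rewrite eqxx.
Qed.

Lemma edges_star1 v u : u != v -> edges (star v [set u]) = [set [set v; u]].
Proof.
move=> uv; rewrite /= (_ : [set u] :\ v = [set u]) ?imset_set1//.
by apply/setP => w; rewrite !inE; case: eqVneq => // ->; rewrite eq_sym (negPf uv).
Qed.

(** This count becomes the exponent when group privacy compares a star with one of its edges. *)
Lemma card_starD1 v u U : u \in U -> v \notin U ->
  #|edges (star v U) :\: edges (star v [set u])| = #|U|.-1.
Proof.
move=> uU vU; have uv : u != v by apply: contraNneq vU => <-.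
rewrite edges_star1//=.
have -> : U :\ v = U.
  by apply/setP => w; rewrite !inE; case: eqVneq => // ->; rewrite (negPf vU).
have := cardsD1 [set v; u] [set [set v; w] | w in U].
rewrite (imset_f (fun w => [set v; w]) uU) card_imset; last exact: setU2_injr.
by move=> ->.
Qed.

Lemma star1_sub {v u U} : u \in U -> edges (star v [set u]) \subset edges (star v U).
Proof.
by move=> uU; apply: imsetS; apply: finset.setSD; rewrite finset.sub1set.
Qed.

(** If [H] had no edge, then [#|M| / gamma <= 0] would make [M] empty, yet the single edge extends
    the empty matching. This is where the value of [gamma] drops out. *)
Lemma approx_star1 {R : realType} {gamma : R} {v u H} : 0 < gamma -> u != v ->
  approx_maximal_matching_size gamma (star v [set u]) H ->
  edges H \subset edges (star v [set u]) -> [set v; u] \in edges H.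
Proof.
move=> g0 uv [M /maxsetP[/andP[+ _] Mmax] MH]; rewrite edges_star1// => sM.
rewrite subset1 => /orP[/eqP ->|/eqP H0]; first exact: set11.
move: MH; rewrite H0 cards0 pmulr_lle0 ?invr_gt0//.
rewrite lern0 cards_eq0 => /eqP M0.
have /esym/setP/(_ [set v; u]) : [set [set v; u]] = M.
  apply: Mmax; last by rewrite M0 finset.sub0set.
  by rewrite /is_matching edges_star1// subxx finset.trivIset1.
by rewrite M0 !inE eqxx.
Qed.

(** Phrased through [solution_edges] rather than the implicit graph: the event is then independent
    of the input graph, so privacy can carry it from one graph to another. *)
Definition uncovered (e : {set V}) : set (implicit_solution V) :=
  [set S | e \notin solution_edges S]%classic.

Lemma star1_uncovered {R : realType} {gamma eps beta : R}
    {A : randomized_algorithm R V} {v u} : 0 < gamma -> u != v ->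
  ((1 - beta)%:E <= A (star v [set u])
     [set S | approx_maximal_matching_size gamma (star v [set u]%SET)
                (implicit_graph (star v [set u]%SET) S)]%classic)%E ->
  (A (star v [set u]) (uncovered [set v; u]) <= beta%:E)%E.
Proof.
move=> g0 uv hA; set P := A _ in hA *.
pose e := [set v; u]; rewrite -/e.
rewrite (_ : uncovered e = ~` [set S | e \in solution_edges S])%classic; last first.
  by apply/seteqP; split => S /= /negP.
rewrite probability_setC// leeBlDl; last exact: fin_num_measure.
apply: (@le_trans _ _ (beta%:E + (1 - beta)%:E)%E).
  by rewrite -EFinD lee_fin; lra.
rewrite addeC; apply: leeD2r; apply: le_trans hA _.
apply: le_measure; rewrite ?inE// => S /= apx.
have := approx_star1 g0 uv apx (subsetIl _ _).
by rewrite inE => /andP[].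
Qed.

Lemma star_uncovered {R : realType} {gamma eps beta : R}
    {A : randomized_algorithm R V} {v u U} :
  0 < gamma -> edge_DP eps A -> u \in U -> v \notin U ->
  ((1 - beta)%:E <= A (star v [set u])
     [set S | approx_maximal_matching_size gamma (star v [set u]%SET)
                (implicit_graph (star v [set u]%SET) S)]%classic)%E ->
  (A (star v U) (uncovered [set v; u]) <=
     (expR (eps * #|U|.-1%:R) * beta)%:E)%E.
Proof.
move=> g0 dpA uU vU hA; have uv : u != v by apply: contraNneq vU => <-.
apply: le_trans (edge_DP_subgraph _ dpA (star1_sub uU)) _.
rewrite card_starD1// EFinM lee_wpmul2l ?lee_fin ?expR_ge0//.
exact: star1_uncovered g0 uv hA.
Qed.

(** The expected number of missed edges is at most [#|U| / 4], whereas degree below [#|U| / 2] means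
    more than [#|U| / 2] missed edges. *)
Lemma star_max_degree {R : realType} {gamma eps beta : R}
    {A : randomized_algorithm R V} {v U} :
  0 < gamma -> edge_DP eps A -> v \notin U -> (0 < #|U|)%N ->
  (forall G, ((1 - beta)%:E <=
     A G [set S | approx_maximal_matching_size gamma G
                    (implicit_graph G S)]%classic)%E) ->
  expR (eps * #|U|.-1%:R) * beta <= 1 / 4 ->
  ((1 / 2)%:E <= A (star v U)
     [set S | (#|U|%:R / 2 <=
                (max_degree (implicit_graph (star v U) S))%:R :> R)%R]%classic)%E.
Proof.
move=> g0 dpA vU U0 hA small.
set P := A (star v U); set Y := [set S | _]%classic.
have U0R : 0 < #|U|%:R :> R by rewrite ltr0n.
pose B u := uncovered [set v; u].
have : ((#|U|%:R / 2 : R)%:E * P (~` Y)%classic <= \sum_(u in U) P (B u))%E.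
  apply: measure_markov_count => //.
  move=> S /negP; rewrite -ltNge => degS.
  pose D := [set u in U | [set v; u] \in edges (implicit_graph (star v U) S)].
  have DS : (#|D| <= max_degree (implicit_graph (star v U) S))%N.
    apply: leq_trans (leq_star_degree _ _ _) _.
    exact: (@leq_bigmax _ (fun w => degree (implicit_graph (star v U) S) w)).
  (* Each pair [[set v; u]] is already an edge of the star, so it survives in the implicit graph
     exactly when the solution covers it. *)
  have -> : \sum_(u in U) \1_(B u) S = #|U :\: D|%:R :> R.
    rewrite -sum1_card natr_sum big_mkcond [RHS]big_mkcond /=.
    apply: eq_bigr => u _; rewrite finset.in_setD [u \in D]inE.
    have [uU|] := boolP (u \in U); last by rewrite andbF.
    have uv : u != v by apply: contraNneq vU => <-.
    have -> : [set v; u] \in edges (implicit_graph (star v U) S) =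
        ([set v; u] \in solution_edges S).
      rewrite finset.in_setI andb_idl// => _.
      by apply/imsetP; exists u; rewrite // !inE uv.
    rewrite indicE andbT; case: (boolP (_ \in solution_edges S)) => h.
      by rewrite memNset//= => /negP; apply.
    by rewrite mem_set.
  have := cardsID D U; rewrite (finset.setIidPr _); last first.
    by apply/fintype.subsetP => u; rewrite inE => /andP[].
  move/(congr1 (fun m => m%:R : R)); rewrite natrD.
  by move: DS; rewrite -(ler_nat R) => DS; lra.
move/le_trans => /(_ (#|U|%:R / 4)%:E) H.
have {H} : ((#|U|%:R / 2 : R)%:E * P (~` Y)%classic <= (#|U|%:R / 4)%:E)%E.
  apply: H; apply: (@le_trans _ _ (\sum_(u in U) (1 / 4 : R)%:E)%E).
    apply: lee_sum => u uU; apply: (le_trans (star_uncovered g0 dpA uU vU (hA _))).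
    by rewrite lee_fin.
  rewrite sumEFin sumr_const -[_ *+ _]mulr_natl lee_fin; lra.
rewrite probability_setC//.
have : P Y \is a fin_num by exact: fin_num_measure.
case: (P Y) => // p _; rewrite -EFinB -EFinM !lee_fin => H.
suff : 1 - p <= 1 / 2 by lra.
by rewrite -(ler_pM2l U0R); lra.
Qed.

End Subgraph.

(** * Choice of the star and the logarithmic bound *)

Lemma exists_subset_card {T : finType} (A : {set T}) (k : nat) :
  (k <= #|A|)%N -> exists2 B : {set T}, B \subset A & #|B| = k.
Proof.
move=> kA; exists [set x in take k (enum A)].
  by apply/fintype.subsetP => x; rewrite inE => /mem_take; rewrite mem_enum.
rewrite cardsE (card_uniqP _) ?take_uniq ?enum_uniq// size_take -cardE.
by move: kA; rewrite leq_eqVlt => /orP[/eqP ->|->]; rewrite ?ltnn.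
Qed.

(* The degree of an implicit solution never exceeds #|V| - 1, so the bound
   ln (1 / beta) / eps is capped at #|V| - 1. *)
Theorem mainTheorem5 (R : realType) :
  exists c : R, 0 < c /\
  forall (V : finType) (n : nat) (gamma eps beta : R)
         (A : randomized_algorithm R V),
    #|V| = n ->
    0 < gamma -> 0 < eps ->
    0 < beta -> beta <= 1 / (16 * expR (4 * eps)) ->
    edge_DP eps A ->
    (forall G : sgraph V,
       ((1 - beta)%:E <=
        A G [set S | approx_maximal_matching_size gamma G
                       (implicit_graph G S)]%classic)%E) ->
    exists G : sgraph V,
      ((1 / 2)%:E <=
       A G [set S | (c * Num.min n.-1%:R (1 / eps * ln (1 / beta))
                      <= (max_degree (implicit_graph G S))%:R)%R]%classic)%E.
Proof.
(* One factor 1/2 comes from Markov's inequality, the other from spending only half of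
   [ln (1 / beta)] on group privacy. *)
exists (1 / 4); split; first by rewrite divr_gt0.
move=> V n gamma eps beta A cV g0 e0 b0 bsmall dpA hA.
(* With at most one vertex no star has a leaf; the minimum is then at most 0 and the edgeless graph
   works. *)
have [n0|n1] := posnP n.-1.
  have card0 e : e \in (finset.set0 : {set {set V}}) -> #|e| = 2 by rewrite inE.
  exists (SGraph card0).
  rewrite (_ : [set S | _]%classic = setT) ?probability_setT ?lee_fin; first lra.
  apply/seteqP; split => // S _ /=; rewrite n0.
  apply: le_trans (ler0n _ _); rewrite pmulr_rle0 ?divr_gt0//.
  by rewrite ge_min lexx.
have /card_gt0P[v _] : (0 < #|V|)%N by rewrite cV; case: (n) n1.
set L := ln (1 / beta); pose t := Num.trunc (L / (2 * eps)).
have b16 : beta <= 1 / 16.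
  have : expR 0 <= expR (4 * eps) by rewrite ler_expR mulr_ge0// ltW.
  rewrite expR0 => ?; apply: le_trans bsmall _.
  by rewrite ler_pdivrMr ?mulr_gt0 ?expR_gt0//; lra.
pose k := minn n.-1 t.+1.
have k0 : (0 < k)%N by rewrite leq_min n1.
have kC : (k <= #|~: [set v]|)%N by rewrite cardsC1 cV geq_minl.
have [U + cU] := exists_subset_card _ _ kC.
rewrite -finset.disjoints_subset disjoint_sym disjoints1 => vU.
exists (star v U).
have LE : expR (- L) = beta.
  by rewrite /L div1r lnV ?posrE// opprK lnK ?posrE.
have L0 : 0 <= L by rewrite ln_ge0// ler_pdivlMr//; lra.
(* [expR (- L / 2)] is the square root of [beta]. *)
have x0 : 0 < expR (- L / 2) by exact: expR_gt0.
have xx : expR (- L / 2) ^+ 2 = beta.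
  by rewrite -expRM_natl mulrC divfK.
have kt : eps * k.-1%:R <= L / 2.
  apply: (@le_trans _ _ (eps * t%:R)).
    rewrite ler_pM2l// ler_nat -ltnS prednK//; exact: geq_minr.
  have : t%:R <= L / (2 * eps) by rewrite truncn_le divr_ge0// mulr_ge0// ltW.
  rewrite -(ler_pM2l e0) => /le_trans; apply.
  by have -> : eps * (L / (2 * eps)) = L / 2 by field; rewrite gt_eqF.
apply: le_trans (star_max_degree g0 dpA vU _ hA _) _.
- by rewrite cU.
(* The product [expR (L / 2) * beta] equals the square root of [beta], at most 1/4 because
   [beta <= 1 / 16]. *)
- rewrite cU; apply: (@le_trans _ _ (expR (L / 2) * beta)).
    by rewrite ler_wpM2r ?ler_expR// ltW.
  rewrite -xx expr2 mulrA -expRD mulNr subrr expR0 mul1r.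
  by move: b16; rewrite -xx mulNr => b16; nra.
apply: le_measure; rewrite ?inE// => S /=; apply: le_trans.
rewrite cU /k; set a := n.-1.
have Lt : L / (2 * eps) < t.+1%:R by exact: truncnS_gt.
have {Lt} Lt : 1 / eps * L < 2 * t.+1%:R.
  have -> : 1 / eps * L = 2 * (L / (2 * eps)) by field; rewrite gt_eqF.
  by rewrite ltr_pM2l.
have a0 : 0 <= a%:R :> R by [].
(* Both cases give [m <= 2 * k]: either [k = n.-1], which bounds [m], or [k = t.+1], which exceeds
   [L / (2 * eps)]. *)
rewrite /minn; case: ifP => _; set m := Num.min _ _.
  have : m <= a%:R by rewrite ge_min lexx.
  by lra.
have : m <= 1 / eps * L by rewrite ge_min lexx orbT.
by lra.
Qed.
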